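(* Let $\varphi$ be an Orlicz function. (i) In the case when $\varphi(b_\varphi)=\infty$, assume that for each $\varepsilon>0$ there exists a constant $D=D(\varepsilon)>0$ such that $$\rho_\varphi(f)\le D\,I_\varphi(f)+\varepsilon$$ for all $f\in KL^\varphi[0,1]$ satisfying $|f(t)|\ge\varphi^{-1}(\varepsilon)$ for a.e. $t\in\operatorname{supp}(f)$. (No such assumption is made when $\varphi(b_\varphi)<\infty$.) If $\varphi\notin\Delta_2(\infty)$, then $Ces_\varphi[0,1]$ contains an order isomorphically isometric copy of $l^\infty$. (ii) If $\varphi\in\Delta_2(\infty)$, then $Ces_\varphi[0,1]$ does not contain an order isomorphic copy of $l^\infty$.
   Context: Here $I=[0,1]$ with Lebesgue measure $\mu$, and $L^0(I)$ is the space of (classes of a.e. equal) real-valued Lebesgue measurable functions on $I$. An Orlicz function is a function $\varphi:[0,\infty)\to[0,\infty]$ that is convex, satisfies $\varphi(0)=0$, is neither identically $0$ nor identically $\infty$ on $(0,\infty)$, and is left continuous on $(0,\infty)$, i.e. $\lim_{u\to b_\varphi^-}\varphi(u)=\varphi(b_\varphi)$ if $b_\varphi<\infty$, where $b_\varphi=\sup\{u>0:\varphi(u)<\infty\}$. Put $a_\varphi=\sup\{u\ge0:\varphi(u)=0\}$. It is assumed throughout that if $b_\varphi<\infty$ then $a_\varphi<b_\varphi$. If $b_\varphi=\infty$, then $\varphi(b_\varphi)$ means $\lim_{u\to\infty}\varphi(u)=\infty$, so the case $\varphi(b_\varphi)=\infty$ includes $b_\varphi=\infty$. When $\varphi(b_\varphi)=\infty$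 and $\varepsilon>0$, $\varphi^{-1}(\varepsilon)$ is the unique $u$ with $\varphi(u)=\varepsilon$. $\varphi\in\Delta_2(\infty)$ means that there are $K>0$ and $u_0>0$ with $\varphi(u_0)<\infty$ and $\varphi(2u)\le K\varphi(u)$ for all $u\ge u_0$. For $f\in L^0(I)$: $I_\varphi(f)=\int_I\varphi(|f(t)|)\,dt$; the Cesàro operator is $Cf(x)=\frac1x\int_0^xf(t)\,dt$ for $0<x\in I$; $\rho_\varphi(f)=I_\varphi(C|f|)$. The Orlicz class is $KL^\varphi(I)=\{f\in L^0(I):I_\varphi(f)<\infty\}$. The Cesàro–Orlicz space is $Ces_\varphi(I)=\{f\in L^0(I):\rho_\varphi(f/\lambda)<\infty\text{ for some }\lambda>0\}$ with norm $\|f\|_{Ces(\varphi)}=\inf\{\lambda>0:\rho_\varphi(f/\lambda)\le1\}$ and the a.e. pointwise order. A Banach function space $E$ contains an order isomorphic copy of $l^\infty$ if there is a linear map $T:l^\infty\to E$ that is an isomorphism onto its range (i.e. $c\|x\|\le\|Tx\|\le c'\|x\|$ for some $c,c'>0$) and satisfies $x\ge0\iff Tx\ge0$; it contains an order isomorphically isometric copy of $l^\infty$ if $T$ can moreover be chosen isometric. *)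

(* Defs.v *)
From HB Require Import structures.
From mathcomp Require Import all_boot all_order all_algebra.
From mathcomp Require Import all_classical all_reals all_analysis.

Set Implicit Arguments.
Unset Strict Implicit.
Unset Printing Implicit Defensive.

Import Order.TTheory GRing.Theory Num.Theory.
Import numFieldNormedType.Exports.

Local Open Scope classical_set_scope.
Local Open Scope ring_scope.
Local Open Scope ereal_scope.

(* A function [0, +oo) -> [0, +oo] is represented by phi : R -> \bar R;
   its values at negative arguments are never constrained nor used. *)
Section orlicz_functions.
Context {R : realType}.
Implicit Types (phi : R -> \bar R) (u v t e : R).

Definition orlicz_a phi : \bar R :=
  ereal_sup [set u%:E | u in [set u : R | (0 <= u)%R /\ phi u = 0]].

Definition orlicz_b phi : \bar R :=
  ereal_sup [set u%:E | u in [set u : R | (0 < u)%R /\ phi u < +oo]].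

Record orlicz_function phi : Prop := OrliczFunction {
  orlicz_ge0 : forall u, (0 <= u)%R -> 0 <= phi u ;
  orlicz_0 : phi 0%R = 0 ;
  orlicz_convex : forall u v t, (0 <= u)%R -> (0 <= v)%R ->
    (0 <= t <= 1)%R ->
    phi (t * u + (1 - t) * v)%R <= t%:E * phi u + (1 - t)%:E * phi v ;
  orlicz_neq0 : exists2 u, (0 < u)%R & phi u != 0 ;
  orlicz_neqy : exists2 u, (0 < u)%R & phi u != +oo ;
  orlicz_left_continuous :
    forall u, (0 < u)%R -> phi v @[v --> u^'-] --> phi u ;
  orlicz_a_lt_b : orlicz_b phi < +oo -> orlicz_a phi < orlicz_b phi }.

(* phi extended by its limit phi(+oo) = +oo; it is only applied to
   nonnegative extended reals (the value at -oo is junk). *)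
Definition orlicz_ext phi (x : \bar R) : \bar R :=
  if x is r%:E then phi r else +oo.

Definition orlicz_inv phi e : R :=
  xget 0%R [set u : R | (0 <= u)%R /\ phi u = e%:E].

Definition Delta2_infty phi : Prop :=
  exists K u0 : R, [/\ (0 < K)%R, (0 < u0)%R, phi u0 < +oo &
    forall u, (u0 <= u)%R -> phi (2 * u)%R <= K%:E * phi u].

End orlicz_functions.

(* Elements of L^0(I) are represented by functions R -> R, of which only the
   restriction to I matters, and equality in L^0(I) is ae_eq lebesgue_measure I.
   Every class of Lebesgue measurable functions modulo a.e. equality has a Borel
   measurable representative, so that the representatives are taken to be
   measurable for the Borel sigma-algebra. *)
Section cesaro_orlicz.
Context {R : realType}.
Implicit Types (phi : R -> \bar R) (f g : R -> R).

Local Notation mu := (@lebesgue_measure R).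

Definition I01 : set R := `[0%R, 1%R].

Definition L0 : set (R -> R) := [set f | measurable_fun I01 f].

(* Extended-valued arguments are needed because the Cesaro mean of |f| is
   infinite when |f| is not integrable near 0. *)
Definition orlicz_modular phi (g : R -> \bar R) : \bar R :=
  \int[mu]_(t in I01) orlicz_ext phi `|g t|.

Definition cesaro f (x : R) : \bar R :=
  (x^-1)%:E * \int[mu]_(t in `[0%R, x]) (f t)%:E.

Definition ces_modular phi f : \bar R :=
  orlicz_modular phi (cesaro (fun t => `|f t|%R)).

Definition orlicz_class phi : set (R -> R) :=
  [set f | L0 f /\ orlicz_modular phi (EFin \o f) < +oo].

Definition Ces phi : set (R -> R) :=
  [set f | L0 f /\
    exists2 l : R, (0 < l)%R & ces_modular phi (fun t => f t / l)%R < +oo].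

Definition ces_norm phi f : R :=
  inf [set l : R | (0 < l)%R /\ ces_modular phi (fun t => f t / l)%R <= 1].

End cesaro_orlicz.

Section copies_of_linfty.
Context {R : realType}.
Implicit Types (x y : nat -> R) (T : (nat -> R) -> (R -> R)).

Local Notation mu := (@lebesgue_measure R).

Definition linfty : set (nat -> R) := [set x | bounded_fun x].

Definition linfty_norm x : R := sup (range (fun n => `|x n|%R)).

(* E is a set of representatives of a space of classes of functions on I, with
   norm N; T is only relevant on linfty. *)
Record order_embedding (E : set (R -> R)) (N : (R -> R) -> R) T : Prop :=
  OrderEmbedding {
  oe_range : forall x, linfty x -> E (T x) ;
  oe_linear : forall (a : R) x y, linfty x -> linfty y ->
    ae_eq mu I01 (T (fun n => a * x n + y n)%R)
                 (fun t => a * T x t + T y t)%R ;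
  oe_iso : exists c c' : R, [/\ (0 < c)%R, (0 < c')%R &
    forall x, linfty x ->
      (c * linfty_norm x <= N (T x) <= c' * linfty_norm x)%R] ;
  oe_order : forall x, linfty x ->
    (forall n, (0 <= x n)%R) <->
    {ae mu, forall t, I01 t -> (0 <= T x t)%R} }.

Definition contains_order_copy_linfty (E : set (R -> R)) (N : (R -> R) -> R) :=
  exists T, order_embedding E N T.

Definition contains_order_isometric_copy_linfty
    (E : set (R -> R)) (N : (R -> R) -> R) :=
  exists2 T, order_embedding E N T &
    forall x, linfty x -> N (T x) = linfty_norm x.

End copies_of_linfty.

(* Main.v *)
Require Import Defs.
From HB Require Import structures.
From mathcomp Require Import all_boot all_order all_algebra.
From mathcomp Require Import all_classical all_reals all_analysis.
From mathcomp Require Import measurable_realfun.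
From mathcomp Require Import lra.
Import Order.TTheory GRing.Theory Num.Theory.
Import numFieldNormedType.Exports.
Local Open Scope classical_set_scope.
Local Open Scope ring_scope.
Local Open Scope ereal_scope.
Set Implicit Arguments.
Unset Strict Implicit.
Unset Printing Implicit Defensive.

(** Both parts rest on how the modular rho(f), the integral of phi over the
    means C|f|, treats disjoint or summed pieces.

    Copy of l^oo when Delta2 fails.  A single function f >= 0 with disjoint
    pieces f_n is built such that rho(f) <= 1 while rho(f_n / l) > 1 for all n
    and all l < 1.  Then x |-> sum_n x_n f_n is the required isometry: the first
    property bounds the norm of the image above by sup |x_n|, the second one
    below.  The function f takes the value u_k on the block ]x_(k+1), x_k],
    where
    - u_k is chosen so that phi((1 + eta_k) u_k) is huge compared with phi(u_k),
      with eta_k -> 0 (fast_growth); the failure of Delta2 provides such values,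
      and when phi(b) < oo, b being the supremum of the points where phi is
      finite, one simply takes u_k = b;
    - x_k is so small that the total modular stays small, yet so large that
      x_k phi((1 + eta_k) u_k) >= 4 (geometric_blocks);
    - x_(k+1) / x_k -> 0, so that on the upper half of a block the mean of f_n is
      almost u_k (mean_block_ge).  Hence one block far enough suffices to make
      rho(f_n / l) exceed 1 as soon as l < 1 (ces_modular_block_gt1).
    Each f_n collects infinitely many blocks.  The bound rho(f) <= 1 comes from
    the assumed inequality between rho and the integral of phi(f) when
    phi(b) = oo, and from a
    direct estimate of the means when phi(b) < oo, where f is bounded by b and
    supported near 0 (ces_modular_bounded).

    No copy of l^oo under Delta2.  Convexity and phi(0) = 0 make phi, hence rho,
    superadditive on nonnegative functions (ces_modular_superadditive).  An
    order copy of l^oo provides g_j >= 0, the images of the unit vectors, whose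
    partial sums stay below the image G of the constant 1.  Thus the sum of the
    rho(g_j / l) is at most rho(G / l), which Delta2 makes finite for every
    l > 0; this contradicts the uniform lower bound on the norms of the g_j. *)

(** * Orlicz functions *)

Section orlicz_basics.
Context {R : realType} (phi : R -> \bar R) (hphi : orlicz_function phi).
Implicit Types (u v t : R) (x y : \bar R).

Lemma orlicz_star t u : (0 <= t <= 1)%R -> (0 <= u)%R ->
  phi (t * u)%R <= t%:E * phi u.
Proof.
move=> t01 u0; have := orlicz_convex hphi u0 (lexx 0%R) t01.
by rewrite mulr0 addr0 (orlicz_0 hphi) mule0 adde0.
Qed.

Lemma orlicz_nd u v : (0 <= u)%R -> (u <= v)%R -> phi u <= phi v.
Proof.
move=> u0 uv; have v0 : (0 <= v)%R by exact: le_trans uv.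
have [v00|vn0] := eqVneq v 0%R.
  suff -> : u = v by [].
  by apply/eqP; rewrite eq_le uv v00.
have vp : (0 < v)%R by rewrite lt_def vn0.
have t01 : (0 <= u / v <= 1)%R by rewrite divr_ge0//= ler_pdivrMr// mul1r.
have := orlicz_star t01 v0; rewrite divfK// => /le_trans; apply.
rewrite -[leRHS]mul1e; apply: lee_wpmul2r; first exact: orlicz_ge0 hphi _ _.
by rewrite lee_fin; case/andP: t01.
Qed.

(** Both phi(u) and phi(v) are compared with the chord from 0 to u + v. *)
Lemma orlicz_superadditive u v : (0 <= u)%R -> (0 <= v)%R ->
  phi u + phi v <= phi (u + v)%R.
Proof.
move=> u0 v0; have [->|un0] := eqVneq u 0%R.
  by rewrite (orlicz_0 hphi) add0e add0r.
have uv0 : (0 < u + v)%R by rewrite ltr_pwDl// lt_def un0.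
have uvn0 : (u + v != 0)%R by rewrite gt_eqF.
have H w : (0 <= w <= u + v)%R -> phi w <= (w / (u + v))%:E * phi (u + v)%R.
  move=> /andP[w0 wuv]; rewrite -[in leLHS](divfK uvn0 w).
  apply: orlicz_star (ltW uv0).
  by rewrite divr_ge0 ?(ltW uv0)//= ler_pdivrMr// mul1r.
apply: le_trans (leeD (H u _) (H v _)) _; rewrite ?u0 ?v0 ?lerDl ?lerDr//.
rewrite -ge0_muleDl ?lee_fin ?divr_ge0 ?(ltW uv0)//.
by rewrite -EFinD -mulrDl divff// mul1e.
Qed.

Lemma orlicz_ext_ge0 x : 0 <= x -> 0 <= orlicz_ext phi x.
Proof. by case: x => [r| |]//=; rewrite ?lee_fin; exact: orlicz_ge0. Qed.

Lemma orlicz_ext_nd x y : 0 <= x -> x <= y ->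
  orlicz_ext phi x <= orlicz_ext phi y.
Proof.
case: x y => [r| |] [s| |]//=; rewrite ?lee_fin ?leey//.
exact: orlicz_nd.
Qed.

Lemma orlicz_ext_sum m (a : nat -> \bar R) : (forall j, 0 <= a j) ->
  \sum_(j < m) orlicz_ext phi (a j) <= orlicz_ext phi (\sum_(j < m) a j).
Proof.
move=> a0; elim: m => [|m IH]; first by rewrite !big_ord0/= (orlicz_0 hphi).
rewrite !big_ord_recr/=; apply: le_trans (leeD2r _ IH) _.
have := a0 m; have : 0 <= \sum_(i < m) a i by exact: sume_ge0.
case: (\sum_(i < m) a i) (a m) => [r| |] [s| |]//=; rewrite ?leey// !lee_fin.
exact: orlicz_superadditive.
Qed.

Lemma orlicz_lt_b u : (0 <= u)%R -> u%:E < orlicz_b phi -> phi u < +oo.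
Proof.
move=> u0 /ereal_sup_gt[_ [v [v0 phiv] <-]]; rewrite lte_fin => uv.
exact: le_lt_trans (orlicz_nd u0 (ltW uv)) phiv.
Qed.

Lemma orlicz_gt_b u : (0 < u)%R -> orlicz_b phi < u%:E -> phi u = +oo.
Proof.
move=> u0 bu; apply/eqP; rewrite eq_le leey leNgt/=; apply/negP => phiu.
by move: bu; rewrite ltNge => /negP; apply; apply: ereal_sup_ubound; exists u.
Qed.

Lemma orlicz_b_gt0 : 0 < orlicz_b phi.
Proof.
have [u u0 phiu] := orlicz_neqy hphi.
apply: (@lt_le_trans _ _ u%:E); first by rewrite lte_fin.
by apply: ereal_sup_ubound; exists u => //; split=> //; rewrite ltey.
Qed.

End orlicz_basics.

(** * The modular of the Cesaro means *)

Section measurability.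
Context {R : realType} d (T : measurableType d).

(** The level set above y of a function that increases with g is a level set
    of g, cut at the infimum of the values of g on it. *)
Lemma measurable_fun_monotone_of (D : set T) (g k : T -> \bar R) :
  measurable_fun D g ->
  (forall s t, D s -> D t -> g s <= g t -> k s <= k t) ->
  measurable_fun D k.
Proof.
move=> mg gk mD; apply: (measurability _ (ErealGenOInfty.measurableE R)) => //.
move=> /= _ [_ [y ->] <-]; rewrite preimage_itvoy.
pose A := [set g s | s in D `&` [set s | y%:E < k s]].
have Aup t s : D t -> D s -> y%:E < k s -> g s <= g t -> y%:E < k t.
  by move=> Dt Ds yk /(gk _ _ Ds Dt); exact: lt_le_trans.
have [[s [Ds /= yks] gs]|nA] := pselect (A (ereal_inf A)).
  rewrite [X in measurable X](_ : _ = D `&` [set t | ereal_inf A <= g t]).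
    exact: emeasurable_fun_c_infty.
  apply/seteqP; split=> t [Dt /= H]; split=> //.
    by apply: ereal_inf_lbound; exists t.
  by apply: (Aup _ _ Dt Ds yks); rewrite gs.
rewrite [X in measurable X](_ : _ = D `&` [set t | ereal_inf A < g t]).
  exact: emeasurable_fun_o_infty.
apply/seteqP; split=> t [Dt /= H]; split=> //.
  rewrite lt_neqAle; apply/andP; split; last first.
    by apply: ereal_inf_lbound; exists t.
  by apply/eqP => E; apply: nA; rewrite E; exists t.
have [_ [s [Ds /= yks] <-] sgt] := ereal_inf_lt H.
exact: (Aup _ _ Dt Ds yks (ltW sgt)).
Qed.

End measurability.

Section cesaro_modular.
Context {R : realType}.
Implicit Types (f g : R -> R) (x : R).

Local Notation mu := (@lebesgue_measure R).
Local Notation mean f := (Defs.cesaro (fun t => `|f t|%R)).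

Lemma aeS (P Q : R -> Prop) : (forall x, P x -> Q x) ->
  {ae mu, forall x, P x} -> {ae mu, forall x, Q x}.
Proof.
have F : Filter (nbhs (almost_everywhere mu)) by exact: ae_filter_ringOfSetsType.
by move=> PQ; exact: filterS.
Qed.

Lemma aeI (P Q : R -> Prop) :
  {ae mu, forall x, P x} -> {ae mu, forall x, Q x} ->
  {ae mu, forall x, P x /\ Q x}.
Proof.
have F : Filter (nbhs (almost_everywhere mu)) by exact: ae_filter_ringOfSetsType.
by move=> Pae Qae; near=> x; split; near: x.
Unshelve. all: by end_near. Qed.

Lemma measurable_I01 : measurable (I01 : set R).
Proof. exact: measurable_itv. Qed.
#[local] Hint Resolve measurable_I01 : core.

Lemma I01P x : I01 x <-> (0 <= x <= 1)%R.
Proof. by rewrite /I01/= in_itv/=. Qed.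

Lemma I01_prefix x : I01 x -> `[0%R, x] `<=` I01.
Proof.
move=> /I01P/andP[x0 x1] t/=; rewrite in_itv/= => /andP[t0 tx].
by apply/I01P; rewrite t0 (le_trans tx).
Qed.

Lemma L0_normE f : L0 f -> measurable_fun I01 (fun t => `|f t|%:E).
Proof.
by move=> mf; apply/measurable_EFinP; apply: measurableT_comp.
Qed.

Lemma L0_norm_prefix f x : L0 f -> I01 x ->
  measurable_fun `[0%R, x] (fun t => `|f t|%:E).
Proof.
move=> mf Ix; apply: measurable_funS (I01_prefix Ix) _ => //.
exact: L0_normE.
Qed.

Lemma mean_ge0 f x : (0 <= x)%R -> 0 <= mean f x.
Proof.
move=> x0; apply: mule_ge0; first by rewrite lee_fin invr_ge0.
by apply: integral_ge0 => t _; rewrite lee_fin.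
Qed.

Lemma measurable_mean f : L0 f -> measurable_fun I01 (mean f).
Proof.
move=> mf; apply: emeasurable_funM.
  apply/measurable_EFinP.
  apply: (@eq_measurable_fun _ _ _ _ _ (fun x => x `^ (-1))%R).
    by move=> x; rewrite inE => /I01P/andP[x0 _]; rewrite powR_inv1.
  by apply: (measurable_funS measurableT) => //; exact: measurable_powR.
apply: (@measurable_fun_monotone_of _ _ _ _ EFin) => //.
move=> s t Is It; rewrite lee_fin => st.
apply: ge0_subset_integral => //=; first exact: L0_norm_prefix.
by move=> u /=; rewrite !in_itv/= => /andP[-> /le_trans->].
Qed.

Lemma mean_sum_le m (g : nat -> R -> R) G x : (forall j, L0 (g j)) -> L0 G ->
  {ae mu, forall t, I01 t -> (\sum_(j < m) `|g j t| <= `|G t|)%R} ->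
  I01 x -> \sum_(j < m) mean (g j) x <= mean G x.
Proof.
move=> mg mG gG Ix; have /I01P/andP[x0 x1] := Ix.
rewrite /Defs.cesaro -ge0_sume_distrr; last first.
  by move=> i _; apply: integral_ge0 => t _; rewrite lee_fin.
apply: lee_wpmul2l; first by rewrite lee_fin invr_ge0.
apply: (@le_trans _ _ (\int[mu]_(t in `[0%R, x]) \sum_(j < m) `|g j t|%:E)).
  by rewrite ge0_integral_sum// => j; exact: L0_norm_prefix.
have {}gG : {ae mu, forall t, `[0%R, x]%classic t ->
    \sum_(j < m) `|g j t|%:E <= `|G t|%:E}.
  move: gG; apply: aeS => t + /(I01_prefix Ix) It => /(_ It).
  by rewrite sumEFin lee_fin.
apply: (ae_ge0_le_integral _ _ _ _ _ gG) => //.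
- by move=> t _; apply: sume_ge0.
- by apply: emeasurable_sum => i; exact: L0_norm_prefix.
- exact: L0_norm_prefix.
Qed.

Lemma meanZ (c : R) f x : L0 f -> I01 x ->
  mean (fun t => c * f t)%R x = `|c|%:E * mean f x.
Proof.
move=> mf Ix; rewrite /Defs.cesaro [RHS]muleCA -[X in _ = _ * X]ge0_integralZl//.
- by congr (_ * _); apply: eq_integral => t _; rewrite normrM EFinM.
- exact: L0_norm_prefix.
Qed.

Section modular.
Context (phi : R -> \bar R) (hphi : orlicz_function phi).

Lemma ces_modularE f :
  ces_modular phi f = \int[mu]_(x in I01) orlicz_ext phi (mean f x).
Proof.
apply: eq_integral => x; rewrite inE => /I01P/andP[x0 _].
by rewrite gee0_abs// mean_ge0.
Qed.

Lemma ext_mean_ge0 f x : I01 x -> 0 <= orlicz_ext phi (mean f x).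
Proof.
by move=> /I01P/andP[x0 _]; exact/(orlicz_ext_ge0 hphi)/mean_ge0.
Qed.

Lemma measurable_ext_mean f : L0 f ->
  measurable_fun I01 (fun x => orlicz_ext phi (mean f x)).
Proof.
move=> mf; apply: measurable_fun_monotone_of (measurable_mean mf) _.
move=> s t /I01P/andP[s0 _] _; apply: (orlicz_ext_nd hphi).
exact: mean_ge0.
Qed.

(** Inherited from the superadditivity of phi and the additivity of means. *)
Lemma ces_modular_superadditive m (g : nat -> R -> R) G :
  (forall j, L0 (g j)) -> L0 G ->
  {ae mu, forall t, I01 t -> (\sum_(j < m) `|g j t| <= `|G t|)%R} ->
  \sum_(j < m) ces_modular phi (g j) <= ces_modular phi G.
Proof.
move=> mg mG gG; under eq_bigr do rewrite ces_modularE.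
rewrite ces_modularE; pose h (j : 'I_m) x := orlicz_ext phi (mean (g j) x).
apply: (@le_trans _ _ (\int[mu]_(x in I01) \sum_(j < m) h j x)).
  rewrite ge0_integral_sum//; first by move=> j; exact: measurable_ext_mean.
  by move=> j x; exact: ext_mean_ge0.
apply: ge0_le_integral => //.
- by move=> x Ix; apply: sume_ge0 => j _; exact: ext_mean_ge0.
- by apply: emeasurable_sum => j; exact: measurable_ext_mean.
- exact: measurable_ext_mean.
move=> x Ix; have /I01P/andP[x0 _] := Ix.
have g0 j : 0 <= mean (g j) x by exact: mean_ge0.
apply: le_trans (orlicz_ext_sum hphi m g0) _.
apply: (orlicz_ext_nd hphi); last exact: mean_sum_le.
exact: sume_ge0.
Qed.

Lemma ces_modular_le f g : L0 f -> L0 g ->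
  {ae mu, forall t, I01 t -> (`|f t| <= `|g t|)%R} ->
  ces_modular phi f <= ces_modular phi g.
Proof.
move=> mf mg fg.
have := @ces_modular_superadditive 1 (fun=> f) g (fun=> mf) mg.
rewrite big_ord_recl big_ord0 adde0; apply.
by move: fg; apply: aeS => t fg It; rewrite big_ord_recl big_ord0 addr0 fg.
Qed.

End modular.
End cesaro_modular.

(** * The modular under Delta2 *)

Section Delta2.
Context {R : realType} (phi : R -> \bar R) (hphi : orlicz_function phi).
Implicit Types (f : R -> R).

Local Notation mu := (@lebesgue_measure R).
Local Notation mean f := (Defs.cesaro (fun t => `|f t|%R)).

(** Delta2 only controls phi(2 u) for u >= u0; for smaller u the constant
    phi(2 u0) is a bound, and it is integrable because I has finite measure. *)
Lemma ces_modular_double f : Delta2_infty phi -> L0 f ->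
  ces_modular phi f < +oo -> ces_modular phi (fun t => 2 * f t)%R < +oo.
Proof.
move=> [K [u0 [K0 u00 phiu0 HK]]] mf fin; rewrite ces_modularE.
have phi2u0 : phi (2 * u0)%R \is a fin_num.
  rewrite ge0_fin_numE; last by apply: (orlicz_ge0 hphi); rewrite mulr_ge0 ?ltW.
  apply: le_lt_trans (HK _ (lexx _)) _; rewrite lte_mul_pinfty//.
    by rewrite lee_fin ltW.
have phi2u0_ge0 : 0 <= phi (2 * u0)%R.
  by apply: (orlicz_ge0 hphi); rewrite mulr_ge0 ?ltW.
have Kge0 : 0 <= K%:E by rewrite lee_fin ltW.
have H y : 0 <= y ->
    orlicz_ext phi (2%:E * y) <= K%:E * orlicz_ext phi y + phi (2 * u0)%R.
  case: y => [r| |]//=; last first.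
    rewrite [K%:E * _]gt0_muley ?lte_fin// addye ?leey//.
    by rewrite gt_eqF// (lt_le_trans _ phi2u0_ge0).
  rewrite lee_fin => r0; have [u0r|/ltW ru0] := leP u0 r.
    by apply: le_trans (HK _ u0r) _; rewrite leeDl.
  apply: (@le_trans _ _ (phi (2 * u0)%R)).
    by apply: (orlicz_nd hphi); rewrite ?mulr_ge0// ler_pM2l.
  by rewrite leeDr// mule_ge0// (orlicz_ge0 hphi).
have mh := measurable_ext_mean hphi mf.
have mK : measurable_fun I01 (fun x => K%:E * orlicz_ext phi (mean f x)).
  exact: measurable_funeM.
apply: (@le_lt_trans _ _ (\int[mu]_(x in I01)
    (K%:E * orlicz_ext phi (mean f x) + phi (2 * u0)%R))).
  apply: ge0_le_integral => //; first exact: measurable_I01.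
  - by move=> x; exact: ext_mean_ge0.
  - by apply: measurable_ext_mean => //; exact: measurable_funM.
  - by apply: emeasurable_funD => //; exact: measurable_cst.
  - move=> x Ix; have /I01P/andP[x0 _] := Ix.
    by rewrite meanZ// ger0_norm//; apply: H; exact: mean_ge0.
have mI := @measurable_I01 R.
rewrite ge0_integralD//; last first.
  by move=> x Ix; rewrite mule_ge0// ext_mean_ge0.
rewrite ge0_integralZl//; last by move=> x; exact: ext_mean_ge0.
rewrite -ces_modularE integral_cst// -(fineK phi2u0).
rewrite lte_add_pinfty// lte_mul_pinfty//; first by rewrite fineK.
by rewrite /I01/= lebesgue_measure_itv/= lte_fin ltr01 -EFinB ltry.
Qed.

Lemma ces_modular_scale f (a : R) : Delta2_infty phi -> L0 f ->
  ces_modular phi f < +oo -> ces_modular phi (fun t => a * f t)%R < +oo.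
Proof.
move=> D2 mf fin.
have [n an] : exists n, (`|a| <= 2 ^+ n)%R.
  exists (Num.bound `|a|); apply: le_trans (ltW (archi_boundP (normr_ge0 a))) _.
  by rewrite -natrX ler_nat ltnW// ltn_expl.
have pow k : ces_modular phi (fun t => 2 ^+ k * f t)%R < +oo.
  elim: k => [|k IH]; first by under eq_fun do rewrite expr0 mul1r.
  under eq_fun do rewrite exprS -mulrA.
  by apply: ces_modular_double => //; exact: measurable_funM.
apply: le_lt_trans (pow n); apply: ces_modular_le => //; try exact: measurable_funM.
apply: aeW => t _; rewrite !normrM ler_wpM2r// (ger0_norm (exprn_ge0 _ _))//.
Qed.

End Delta2.

(** * Order copies of l^oo are excluded by Delta2 *)

Section linfty_basics.
Context {R : realType}.
Implicit Types (x : nat -> R).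

Lemma linftyP x : linfty x <-> exists M, forall n, (`|x n| <= M)%R.
Proof.
have F : ProperFilter (globally [set: nat]).
  exact: (@globally_properfilter _ _ 0%N).
have [bM Mb] := @ex_bound nat R R^o x _ F; split=> [/bM[M HM]|[M HM]].
  by exists M => n; exact: HM.
by apply: Mb; exists M => n _; exact: HM.
Qed.

Lemma linfty_norm_ub x n : linfty x -> (`|x n| <= linfty_norm x)%R.
Proof.
move=> /linftyP[M HM]; apply: ub_le_sup; last by exists n.
by exists M => _ [k _ <-]; exact: HM.
Qed.

Lemma linfty_norm_le x M : (forall n, (`|x n| <= M)%R) -> (linfty_norm x <= M)%R.
Proof.
by move=> HM; apply: ge_sup; [exists `|x 0%N|%R; exists 0%N|move=> _ [n _ <-]].
Qed.

End linfty_basics.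

Section Delta2_no_copy.
Context {R : realType} (phi : R -> \bar R) (hphi : orlicz_function phi).

Local Notation mu := (@lebesgue_measure R).

Let e (j n : nat) : R := (n == j)%:R.
Let pre (m n : nat) : R := (n < m)%N%:R.
Let post (m n : nat) : R := (m <= n)%N%:R.

Let bool_linfty (p : pred nat) : linfty (fun n => (p n)%:R : R).
Proof. by apply/linftyP; exists 1%R => n; case: (p n); rewrite ?normr1 ?normr0. Qed.

Let ae_sum_units (E : set (R -> R)) N (T : (nat -> R) -> R -> R) :
  order_embedding E N T -> forall m,
  {ae mu, forall t, I01 t -> T (pre m) t = (\sum_(j < m) T (e j) t)%R}.
Proof.
move=> [_ lin _ _]; elim=> [|m IH].
  have pre0 : pre 0 = (fun n => 1 * pre 0 n + pre 0 n)%R.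
    by apply/funext => n; rewrite /pre ltn0 mulr0 addr0.
  have := lin 1%R _ _ (bool_linfty (fun n => n < 0)%N)
    (bool_linfty (fun n => n < 0)%N).
  rewrite -[X in T X]pre0; apply: aeS => t /[apply].
  by rewrite mul1r big_ord0 => /eqP; rewrite -subr_eq subrr => /eqP.
have preS : pre m.+1 = (fun n => 1 * e m n + pre m n)%R.
  apply/funext => n; rewrite /pre /e ltnS leq_eqVlt mul1r.
  by case: ltngtP; rewrite ?addr0 ?add0r.
have := lin 1%R _ _ (bool_linfty (eq_op^~ m)) (bool_linfty (fun n => n < m)%N).
rewrite -[X in T X]preS => H; apply: aeS (aeI H IH) => t [+ +] It.
by move=> /(_ It) -> /(_ It) IHt; rewrite mul1r big_ord_recr/= addrC IHt.
Qed.

(** The image of the constant sequence 1 is the sum of those of the first m unit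
    vectors and of the indicator of [m, oo[, and all of them are nonnegative. *)
Let ae_sum_abs_units (E : set (R -> R)) N (T : (nat -> R) -> R -> R) :
  order_embedding E N T -> forall m,
  {ae mu, forall t, I01 t ->
    (\sum_(j < m) `|T (e j) t| <= `|T (cst 1) t|)%R}.
Proof.
move=> Temb m; have [_ lin _ ord] := Temb.
have one_linfty : linfty (cst 1%R : nat -> R) by exact: (bool_linfty xpredT).
have pos (p : pred nat) :
    {ae mu, forall t, I01 t -> (0 <= T (fun n => (p n)%:R) t)%R}.
  by apply/(ord _ (bool_linfty p)) => n; rewrite ler0n.
have split1 : cst 1%R = (fun n => 1 * pre m n + post m n)%R.
  apply/funext => n; rewrite /pre /post/= mul1r.
  by case: leqP; rewrite ?addr0 ?add0r.
have := lin 1%R _ _ (bool_linfty (fun n => n < m)%N) (bool_linfty (leq m)).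
rewrite -[X in T X]split1 => H.
have posj : {ae mu, forall t, forall j, I01 t -> (0 <= T (e j) t)%R}.
  by apply: ae_foralln => j; exact: (pos (eq_op^~ j)).
apply: aeS (aeI (aeI posj H) (aeI (ae_sum_units Temb m) (pos (leq m)))).
move=> t [[ej Tt] [sumt post0]] It; rewrite (Tt It) mul1r (sumt It).
apply: le_trans (ler_norm _).
rewrite (eq_bigr (fun j : 'I_m => T (e j) t)); last first.
  by move=> j _; rewrite ger0_norm// ej.
by rewrite lerDl post0.
Qed.

(** Superadditivity bounds the sum of the modulars of the images of the unit
    vectors by the modular of the image of 1, which is finite at every scale
    under Delta2; so these modulars cannot all exceed 1, while the lower bound
    of the embedding requires it. *)
Lemma Delta2_no_order_copy :
  Delta2_infty phi -> ~ contains_order_copy_linfty (Ces phi) (ces_norm phi).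
Proof.
move=> D2 [T Temb]; have [rng _ [c [c' [c0 _ cT]]] _] := Temb.
have one_linfty : linfty (cst 1%R : nat -> R) by exact: (bool_linfty xpredT).
have [mone [l0 l00 fin0]] := rng _ one_linfty.
have mT j : L0 (T (e j)) by have [] := rng _ (bool_linfty (eq_op^~ j)).
(* Any scale below the lower bound c of the embedding serves. *)
pose l := (c / 2)%R; have l_gt0 : (0 < l)%R by rewrite divr_gt0.
pose g j t := (T (e j) t / l)%R; pose G t := (T (cst 1%R) t / l)%R.
have mg j : L0 (g j) by apply: measurable_funM => //; exact: mT.
have mG : L0 G by exact: measurable_funM.
have finG : ces_modular phi G < +oo.
  have -> : G = (fun t => (l0 / l) * (T (cst 1%R) t / l0))%R.
    by apply/funext => t; rewrite /G [RHS]mulrC mulrA divfK ?gt_eqF.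
  by apply: (ces_modular_scale hphi _ D2 _ fin0); exact: measurable_funM.
have rho1 j : 1 <= ces_modular phi (g j).
  rewrite leNgt; apply/negP => /ltW small.
  have : (ces_norm phi (T (e j)) <= l)%R.
    by apply: ge_inf; [exists 0%R => ? [/ltW]|split].
  apply/negP; rewrite -ltNge.
  have /andP[+ _] := cT _ (bool_linfty (eq_op^~ j)); apply: lt_le_trans.
  apply: (@lt_le_trans _ _ c); first by rewrite /l ltr_pdivrMr// ltr_pMr// ltr1n.
  rewrite ler_pMr//.
  by have := linfty_norm_ub j (bool_linfty (eq_op^~ j)); rewrite eqxx normr1.
have bound m : m%:R%:E <= ces_modular phi G.
  have gG : {ae mu, forall t, I01 t -> (\sum_(j < m) `|g j t| <= `|G t|)%R}.
    apply: aeS (ae_sum_abs_units Temb m) => t /[apply] H.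
    rewrite /g /G normrM; under eq_bigr do rewrite normrM.
    by rewrite -mulr_suml ler_wpM2r.
  apply: le_trans (ces_modular_superadditive hphi mg mG gG).
  apply: (@le_trans _ _ (\sum_(j < m) 1)); last exact: lee_sum.
  by rewrite sumEFin lee_fin sumr_const card_ord.
have G0 := le_trans (lexx _) (bound 0%N).
have Gfin : ces_modular phi G \is a fin_num by rewrite ge0_fin_numE.
have := bound (Num.bound (fine (ces_modular phi G))).
rewrite -(fineK Gfin) lee_fin; apply/negP; rewrite -ltNge.
by apply: archi_boundP; rewrite fine_ge0.
Qed.

End Delta2_no_copy.

(** * Points of fast growth *)

Lemma expr_unbounded (R : realType) (q A : R) : (1 < q)%R ->
  exists k, (A <= q ^+ k)%R.
Proof.
move=> q1; have q10 : (0 < q - 1)%R by rewrite subr_gt0.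
have linear k : (k%:R * (q - 1) <= q ^+ k)%R.
  elim: k => [|k IH]; first by rewrite mul0r.
  have -> : (q ^+ k.+1 = q ^+ k + (q - 1) * q ^+ k)%R.
    by rewrite mulrBl mul1r -exprS addrC subrK.
  by rewrite -natr1 mulrDl mul1r lerD// ler_pMr// exprn_ege1// ltW.
exists (Num.bound (`|A| / (q - 1))); apply: le_trans (linear _).
rewrite -ler_pdivrMr//; apply: le_trans (ltW (archi_boundP _)).
  by rewrite ler_pM2r ?invr_gt0// ler_norm.
by rewrite divr_ge0// ltW.
Qed.

Section growth.
Context {R : realType} (phi : R -> \bar R) (hphi : orlicz_function phi).
Implicit Types (u eta M : R).

(** P records what else is wanted of the points u: a lower bound on phi(u), or
    the value of u.  The term 1 + phi(u) instead of phi(u) makes phi((1 + eta) u)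
    large also where phi(u) is small. *)
Definition fast_growth (P : R -> Prop) := forall eta M, (0 < eta)%R ->
  exists u, [/\ (0 < u)%R, P u, phi u < +oo &
    M%:E * (1 + phi u) <= phi ((1 + eta) * u)%R].

Hypothesis phib : orlicz_ext phi (orlicz_b phi) = +oo.

(** If b < oo, phi tends to phi(b) = oo on the left of b; if b = oo, phi is
    finite and grows at least linearly. *)
Lemma orlicz_finite_ge1 : exists u, [/\ (0 < u)%R, 1 <= phi u & phi u < +oo].
Proof.
have b0 := orlicz_b_gt0 hphi.
case: (orlicz_b phi) b0 phib (@orlicz_lt_b _ _ hphi) => [b| |]//=.
  rewrite lte_fin => b0 phibE fin.
  have large : \forall v \near b^'-, 1 < phi v.
    have /(_ [set y | 1 < y]) := orlicz_left_continuous hphi b0.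
    apply; rewrite phibE.
    by exists 1%R; split => //; rewrite num_real.
  have [v [[v1 v0] vb]] : exists v, (1 < phi v /\ (0 < v)%R) /\ (v < b)%R.
    near b^'- => v; exists v; split; first split; near: v => //.
    - exact: nbhs_left_gt.
    - exact: nbhs_left_lt.
  by exists v; split=> //; [exact: ltW|apply: fin; rewrite ?lte_fin ?ltW].
move=> _ _ fin; have [v v0 phiv] := orlicz_neq0 hphi.
have phivfin u : (0 <= u)%R -> phi u < +oo by move=> u0; apply: fin; rewrite ?ltry.
have pv0 : 0 <= phi v by apply: (orlicz_ge0 hphi); rewrite ltW.
have pvfin : phi v \is a fin_num by rewrite ge0_fin_numE// phivfin// ltW.
have p0 : (0 < fine (phi v))%R.
  by rewrite fine_gt0// phivfin ?(ltW v0)// lt_def phiv pv0.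
pose s := (1 + (fine (phi v))^-1)%R.
have s0 : (0 < s)%R by rewrite ltr_pwDl// invr_ge0 ltW.
exists (s * v)%R; split; [by rewrite mulr_gt0| |by rewrite phivfin// mulr_ge0 ?ltW].
have s01 : (0 <= s^-1 <= 1)%R.
  by rewrite invr_ge0 (ltW s0)/= invf_le1// lerDl invr_ge0 ltW.
have := orlicz_star hphi s01 (mulr_ge0 (ltW s0) (ltW v0)).
rewrite mulKf ?gt_eqF// -[in leLHS](fineK pvfin) => H.
have svfin : phi (s * v)%R \is a fin_num.
  rewrite ge0_fin_numE; first by rewrite phivfin// mulr_ge0 ?ltW.
  by apply: (orlicz_ge0 hphi); rewrite mulr_ge0 ?ltW.
move: H; rewrite -(fineK svfin) -EFinM !lee_fin ler_pdivlMl//; apply: le_trans.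
by rewrite /s mulrDl mul1r mulVf ?gt_eqF// lerDr ltW.
Unshelve. all: by end_near. Qed.

(** If the ratio of phi at (1 + eta) u and at u stayed bounded, iterating this
    bound until (1 + eta) ^ k >= 2 would give Delta2. *)
Lemma not_Delta2_fast_growth : ~ Delta2_infty phi ->
  fast_growth (fun u => 1 <= phi u).
Proof.
move=> nD2 eta M eta0; apply: contrapT => slow; apply: nD2.
have [u0 [u00 phiu0 fin0]] := orlicz_finite_ge1.
pose N := (2 * `|M| + 1)%R; have N0 : (0 < N)%R by rewrite ltr_pwDr// mulr_ge0.
have q1 : (1 < 1 + eta)%R by rewrite ltrDl.
have step u : (u0 <= u)%R -> phi u < +oo ->
    phi ((1 + eta) * u)%R <= N%:E * phi u.
  move=> u0u finu; have up : (0 < u)%R by exact: lt_le_trans u0u.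
  have phi1 : 1 <= phi u by exact: le_trans (orlicz_nd hphi (ltW u00) u0u).
  have phi_ge0 : 0 <= phi u by exact: le_trans phi1.
  rewrite leNgt; apply/negP => big; apply: slow; exists u; split=> //.
  apply: le_trans (ltW big); rewrite -(fineK (_ : phi u \is a fin_num)); last first.
    by rewrite ge0_fin_numE.
  move: phi1; rewrite -(fineK (_ : phi u \is a fin_num)); last first.
    by rewrite ge0_fin_numE.
  rewrite lee_fin -EFinD -!EFinM lee_fin => phi1.
  have p0 : (0 <= 1 + fine (phi u))%R by rewrite addr_ge0// fine_ge0.
  apply: le_trans (ler_wpM2r p0 (ler_norm _)) _.
  apply: (@le_trans _ _ (`|M| * (2 * fine (phi u)))%R).
    by rewrite ler_wpM2l// mulr_natl mulr2n lerD2r.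
  by rewrite mulrA (mulrC `|M|%R) ler_wpM2r ?fine_ge0// lerDl.
have iter k u : (u0 <= u)%R -> phi u < +oo ->
    phi ((1 + eta) ^+ k * u)%R <= (N ^+ k)%:E * phi u.
  move=> u0u finu; have up : (0 < u)%R by exact: lt_le_trans u0u.
  elim: k => [|k IH]; first by rewrite !expr0 mul1r mul1e.
  rewrite exprS -mulrA; apply: le_trans (step _ _ _) _.
  - by apply: le_trans u0u _; rewrite ler_peMl ?(ltW up)// exprn_ege1// ltW.
  - apply: le_lt_trans IH _; rewrite lte_mul_pinfty// lee_fin exprn_ge0//.
    exact: ltW.
  - by rewrite exprS EFinM -muleA lee_wpmul2l// lee_fin ltW.
have fin u : (u0 <= u)%R -> phi u < +oo.
  move=> u0u; have [k uk] := expr_unbounded (u / u0) q1.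
  apply: (@le_lt_trans _ _ (phi ((1 + eta) ^+ k * u0)%R)).
    apply: (orlicz_nd hphi); first by rewrite (le_trans (ltW u00)).
    by rewrite -ler_pdivrMr.
  apply: le_lt_trans (iter k u0 (lexx _) fin0) _.
  by rewrite lte_mul_pinfty// lee_fin exprn_ge0// ltW.
have [k k2] := expr_unbounded 2 q1.
exists (N ^+ k)%R, u0; split=> //; first by rewrite exprn_gt0.
move=> u u0u; have up : (0 < u)%R by exact: lt_le_trans u0u.
apply: le_trans (iter k u u0u (fin u u0u)).
apply: (orlicz_nd hphi); first by rewrite mulr_ge0 ?ltW.
by rewrite ler_pM2r.
Qed.

Lemma orlicz_inv_le eps u : (0 <= u)%R -> eps%:E < phi u ->
  (orlicz_inv phi eps <= u)%R.
Proof.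
move=> u0 epsu; rewrite /orlicz_inv; case: xgetP => //= v _ [v0 phiv].
rewrite leNgt; apply/negP => /ltW /(orlicz_nd hphi u0).
by rewrite phiv leNgt epsu.
Qed.
End growth.

Section bounded_growth.
Context {R : realType} (phi : R -> \bar R) (hphi : orlicz_function phi).

(** The point b itself works, since phi is infinite beyond it. *)
Lemma finite_b_fast_growth (b : R) : orlicz_b phi = b%:E ->
  phi b < +oo -> fast_growth phi (eq b).
Proof.
move=> bE phib eta M eta0.
have b0 : (0 < b)%R by rewrite -lte_fin -bE orlicz_b_gt0.
exists b; split=> //; rewrite (@orlicz_gt_b _ phi ((1 + eta) * b)%R) ?leey//.
  by rewrite mulr_gt0// ltr_pwDl// ltW.
by rewrite bE lte_fin ltr_pMl// ltrDl.
Qed.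
End bounded_growth.

(** * The block operator *)

(** The points u_k and x_k are chosen together by recursion: given the upper
    bound p on x_k imposed by x_(k-1), take u_k with growth factor
    4 / min(p, delta / 2 ^ (k + 1)), and
    x_k = min(p, delta / 2 ^ (k + 1)) / (1 + phi(u_k)). *)
Lemma geometric_blocks (R : realType) (phi : R -> \bar R) (P : R -> Prop)
    (delta : R) : orlicz_function phi -> fast_growth phi P -> (0 < delta)%R ->
  exists u x : nat -> R, (x 0%N <= delta)%R /\ forall k,
    [/\ [/\ (0 < x k)%R & (x k.+1 <= x k / k.+2%:R)%R],
      [/\ (0 < u k)%R, P (u k) & phi (u k) < +oo],
      (x k)%:E * phi (u k) <= (delta / (2 ^ k.+1)%:R)%:E &
      4%:E <= (x k)%:E * phi ((1 + k.+2%:R^-1) * u k)%R].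
Proof.
move=> hphi growth delta0.
pose Q (kp : nat * R) (ux : R * R) := (0 < kp.2)%R ->
  [/\ (0 < ux.2 <= kp.2)%R, [/\ (0 < ux.1)%R, P ux.1 & phi ux.1 < +oo],
      ux.2%:E * phi ux.1 <= (delta / (2 ^ kp.1.+1)%:R)%:E &
      4%:E <= ux.2%:E * phi ((1 + kp.1.+2%:R^-1) * ux.1)%R].
have [f fQ] : {f & forall kp, Q kp (f kp)}.
  apply: choice => -[k p]; rewrite /Q/=.
  have [p0|] := boolP (0 < p)%R; last by exists (0%R, 0%R).
  pose d := (delta / (2 ^ k.+1)%:R)%R.
  have d0 : (0 < d)%R by rewrite divr_gt0// ltr0n expn_gt0.
  pose m := Num.min p d; have m0 : (0 < m)%R by rewrite lt_min p0.
  have [|u [u0 Pu finu Mu]] := growth (k.+2%:R^-1)%R (4 / m)%R.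
    by rewrite invr_gt0.
  have phi0 : 0 <= phi u by apply: (orlicz_ge0 hphi); exact: ltW.
  have phifin : phi u \is a fin_num by rewrite ge0_fin_numE.
  have pge0 : (0 <= fine (phi u))%R by rewrite fine_ge0.
  have p1 : (0 < 1 + fine (phi u))%R by rewrite ltr_pwDl.
  exists (u, m / (1 + fine (phi u)))%R => _ /=; split => //.
  - rewrite divr_gt0//= ler_pdivrMr//.
    apply: (@le_trans _ _ p); first by rewrite ge_min lexx.
    by rewrite ler_peMr ?(ltW p0)// lerDl.
  - rewrite -(fineK phifin) -EFinM lee_fin mulrAC ler_pdivrMr//.
    by rewrite ler_pM ?(ltW m0)// ?ge_min ?lexx ?orbT// lerDr.
  - have y0 : (0 <= m / (1 + fine (phi u)))%R by rewrite ltW// divr_gt0.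
    apply: le_trans (lee_wpmul2l _ Mu); rewrite ?lee_fin//.
    rewrite -(fineK phifin) -EFinD -!EFinM lee_fin.
    rewrite [leRHS]mulrC -mulrA [X in (_ * X)%R]mulrC divfK ?gt_eqF//.
    by rewrite divfK// gt_eqF.
pose p := fix p k := if k is j.+1 then ((f (j, p j)).2 / j.+2%:R)%R else delta.
have p_gt0 k : (0 < p k)%R.
  elim: k => [//|k IH] /=; have [/andP[x0 _] _ _ _] := fQ (k, p k) IH.
  by rewrite divr_gt0.
exists (fun k => (f (k, p k)).1), (fun k => (f (k, p k)).2); split.
  by have [/andP[_]] := fQ (0%N, p 0%N) (p_gt0 0%N).
move=> k; have [/andP[x0 _] ? ? ?] := fQ (k, p k) (p_gt0 k).
by split=> //; split=> //; have [/andP[_]] := fQ (k.+1, p k.+1) (p_gt0 k.+1).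
Qed.

Section block_operator.
Context {R : realType} (u x : nat -> R).
Hypothesis u_gt0 : forall k, (0 < u k)%R.
Hypothesis x_gt0 : forall k, (0 < x k)%R.
Hypothesis x0_le1 : (x 0%N <= 1)%R.
Hypothesis xS : forall k, (x k.+1 <= x k / k.+2%:R)%R.
Implicit Types (y : nat -> R).

Local Notation mu := (@lebesgue_measure R).
Local Notation mean f := (Defs.cesaro (fun t => `|f t|%R)).

Definition block k : set R := `]x k.+1, x k].

(** With the 2-adic valuation as code, every coordinate gets infinitely many
    blocks. *)
Definition block_coord k := logn 2 k.+1.

Lemma block_coord_infinite n K : exists2 k, (K <= k)%N & block_coord k = n.
Proof.
exists (2 ^ n * K.*2.+1).-1.
  rewrite -ltnS prednK ?muln_gt0 ?expn_gt0//.
  apply: (@leq_trans K.*2.+1); first by rewrite ltnS -addnn leq_addr.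
  by rewrite leq_pmull ?expn_gt0.
rewrite /block_coord prednK ?muln_gt0 ?expn_gt0// lognM ?expn_gt0// pfactorK//.
rewrite logn_coprime ?addn0//.
by rewrite coprime2n /= odd_double.
Qed.

(** With this map into nat, the measurability of the images of all sequences
    reduces to that of the blocks. *)
Definition block_index t : nat := get [set m | if m is k.+1 then block k t
                                   else forall k, ~ block k t].

Definition block_operator y t : R :=
  if block_index t is k.+1 then (y (block_coord k) * u k)%R else 0%R.

Lemma block_end_nincr i j : (i <= j)%N -> (x j <= x i)%R.
Proof.
elim: j => [|j IH]; first by rewrite leqn0 => /eqP ->.
rewrite leq_eqVlt => /predU1P[->//|]; rewrite ltnS => /IH; apply: le_trans.
apply: le_trans (xS j) _; rewrite ler_pdivrMr// ler_peMr ?ler1n//.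
exact: ltW.
Qed.

Lemma block_end_le1 k : (x k <= 1)%R.
Proof. by apply: le_trans x0_le1; exact: block_end_nincr. Qed.

Lemma block_I01 k : block k `<=` I01.
Proof.
move=> t; rewrite /block/= in_itv/= => /andP[xt tx]; apply/I01P.
by rewrite (ltW (lt_trans _ xt))//= (le_trans tx)// block_end_le1.
Qed.

Lemma block_inj i j t : block i t -> block j t -> i = j.
Proof.
wlog ij : i j / (i < j)%N => [H bi bj|].
  by have [/H|/H|] := ltngtP i j => //; [exact|move=> /(_ bj bi)].
rewrite /block/= !in_itv/= => /andP[xt _] /andP[_ tx].
by have := lt_le_trans xt (le_trans tx (block_end_nincr ij)); rewrite ltxx.
Qed.

Lemma block_indexE t m : block_index t = m <->
  if m is k.+1 then block k t else forall k, ~ block k t.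
Proof.
pose S := [set m | if m is k.+1 then block k t else forall k, ~ block k t].
have H : S (block_index t).
  suff [i Si] : exists i, S i by exact: (getPex (ex_intro _ i Si)).
  have [[k bk]|nb] := pselect (exists k, block k t); first by exists k.+1.
  by exists 0%N => k bk; apply: nb; exists k.
split=> [<-//|]; move: H; rewrite /S/=; case: m (block_index t) => [|m] [|n]//.
- by move=> bn /(_ n).
- by move=> nb /nb.
- by move=> bn bm; rewrite (block_inj bn bm).
Qed.

Lemma block_operatorE y k t : block k t ->
  block_operator y t = (y (block_coord k) * u k)%R.
Proof. by rewrite /block_operator => /(block_indexE t k.+1).2 ->. Qed.

Lemma block_operator_out y t : (forall k, ~ block k t) ->
  block_operator y t = 0%R.
Proof. by rewrite /block_operator => /(block_indexE t 0).2 ->. Qed.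

Lemma blockP t : (exists k, block k t) \/ (forall k, ~ block k t).
Proof.
by have [?|nb] := pselect (exists k, block k t);
  [left|right=> k bk; apply: nb; exists k].
Qed.

Lemma measurable_block_index : measurable_fun [set: R] block_index.
Proof.
move=> _ Y _; rewrite setTI.
have -> : block_index @^-1` Y = \bigcup_(m in Y) [set t | block_index t = m].
  by apply/seteqP; split=> t /=; [move=> ?; exists (block_index t)|move=> [m ? ->]].
have mblock k : measurable (block k) by exact: measurable_itv.
apply: bigcup_measurable => -[|k] _.
  rewrite (_ : [set t | _] = ~` \bigcup_k block k).
    by apply: measurableC; exact: bigcup_measurable.
  apply/seteqP; split=> t /=; rewrite block_indexE => H; first by case=> k _ /H.
  by move=> k bk; apply: H; exists k.
rewrite (_ : [set t | _] = block k)//.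
by apply/seteqP; split=> t /=; rewrite block_indexE.
Qed.

Lemma block_operator_L0 y : L0 (block_operator y).
Proof.
apply: (measurable_funS measurableT) => //.
pose c m : R := if m is k.+1 then (y (block_coord k) * u k)%R else 0%R.
have mc : measurable_fun setT c by [].
exact: (measurableT_comp mc measurable_block_index).
Qed.

Lemma block_operator_linear a y z t :
  block_operator (fun n => a * y n + z n)%R t =
  (a * block_operator y t + block_operator z t)%R.
Proof.
rewrite /block_operator; case: (block_index t) => [|k]; first by rewrite mulr0 addr0.
by rewrite mulrDl mulrA.
Qed.

Local Notation f := (block_operator (cst 1%R)).

Lemma block_operator1E k t : block k t -> f t = u k.
Proof. by move=> /block_operatorE ->; rewrite /cst mul1r. Qed.

Lemma block_operator1_ge0 t : (0 <= f t)%R.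
Proof.
by have [[k /block_operator1E ->]|/block_operator_out ->//] := blockP t; exact: ltW.
Qed.

Lemma block_operator_le y t : linfty y ->
  (`|block_operator y t| <= linfty_norm y * f t)%R.
Proof.
move=> ly; have [[k bk]|nb] := blockP t.
  rewrite (block_operator1E bk) (block_operatorE y bk) normrM (gtr0_norm (u_gt0 k)).
  by rewrite ler_pM2r// linfty_norm_ub.
by rewrite !block_operator_out// normr0 mulr0.
Qed.

End block_operator.

(** * Isometry of the block operator *)

Section block_copy.
Context {R : realType} (phi : R -> \bar R) (hphi : orlicz_function phi).
Context (u x : nat -> R).
Hypothesis u_gt0 : forall k, (0 < u k)%R.
Hypothesis x_gt0 : forall k, (0 < x k)%R.
Hypothesis x0_le1 : (x 0%N <= 1)%R.
Hypothesis xS : forall k, (x k.+1 <= x k / k.+2%:R)%R.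
Hypothesis phi_large : forall k,
  4%:E <= (x k)%:E * phi ((1 + k.+2%:R^-1) * u k)%R.
Hypothesis one_modular : ces_modular phi (block_operator u x (cst 1%R)) <= 1.

Local Notation mu := (@lebesgue_measure R).
Local Notation mean f := (Defs.cesaro (fun t => `|f t|%R)).
Local Notation T := (block_operator u x).

(** For s in the upper half of the k-th block, x_(k+1) <= 2 s / (k + 2), so the
    block covers all of [0, s] but a fraction 2 / (k + 2). *)
Lemma mean_block_ge y (l s : R) k : (0 < l)%R ->
  (x k / 2 <= s <= x k)%R ->
  ((`|y (block_coord k)| / l * u k * (1 - 2 / k.+2%:R))%:E <=
    mean (fun t => T y t / l)%R s).
Proof.
move=> l0 /andP[xs sx]; set v := (`|y (block_coord k)| / l * u k)%R.
have s0 : (0 < s)%R by rewrite (lt_le_trans _ xs)// divr_gt0.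
have Is : I01 s by apply/I01P; rewrite (ltW s0) (le_trans sx)// block_end_le1.
have v0 : (0 <= v)%R by rewrite mulr_ge0// ?divr_ge0// ltW.
have mg : L0 (fun t => T y t / l)%R.
  by apply: measurable_funM => //; exact: block_operator_L0.
have xs1 : (x k.+1 <= s)%R.
  apply: le_trans (xS k) (le_trans _ xs).
  by rewrite ler_pM2l// lef_pV2 ?posrE// ler_nat.
have int : (v * (s - x k.+1))%:E <=
    \int[mu]_(t in `[0%R, s]) `|T y t / l|%:E.
  apply: (@le_trans _ _ (\int[mu]_(t in `]x k.+1, s]) `|T y t / l|%:E)).
    rewrite (eq_integral (cst v%:E)); last first.
      move=> t; rewrite inE/= in_itv/= => /andP[xt ts].
      have bt : block x k t by rewrite /block/= in_itv/= xt (le_trans ts).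
      rewrite (block_operatorE u x_gt0 xS y bt).
      by rewrite /v !normrM normfV (gtr0_norm (u_gt0 k)) (gtr0_norm l0) mulrAC.
    rewrite integral_cst//= lebesgue_measure_itv/= lte_fin.
    have [_|sx1] := ltP (x k.+1) s; first by rewrite -EFinB -EFinM.
    by rewrite mule0 lee_fin mulr_ge0_le0 ?subr_le0.
  apply: ge0_subset_integral => //; first exact: (L0_norm_prefix mg).
  move=> t /=; rewrite !in_itv/= => /andP[/ltW xt ->].
  by rewrite (le_trans (ltW (x_gt0 k.+1)) xt).
have si0 : 0 <= (s^-1)%:E by rewrite lee_fin invr_ge0 ltW.
rewrite /Defs.cesaro; apply: le_trans (lee_wpmul2l si0 int).
rewrite -EFinM lee_fin ler_pdivlMl// mulrCA ler_wpM2l//.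
rewrite mulrBr mulr1 lerD2l lerN2; apply: le_trans (xS k) _.
rewrite mulrA ler_pM2r ?invr_gt0//.
by rewrite -ler_pdivrMr.
Qed.

(** If l < |y n| then far enough among the blocks of the n-th coordinate the
    loss in the mean is smaller than the gain |y n| / l > 1. *)
Lemma ces_modular_block_gt1 y (l : R) n : (0 < l)%R -> (l < `|y n|)%R ->
  1 < ces_modular phi (fun t => T y t / l)%R.
Proof.
move=> l0 ly; pose c := (`|y n| / l)%R.
have c1 : (1 < c)%R by rewrite ltr_pdivlMr// mul1r.
(* eps is the solution r of 1 + r = c (1 - 2 r). *)
pose eps := ((c - 1) / (2 * c + 1))%R.
have [k Kk nk] := block_coord_infinite n (Num.bound eps^-1).
pose r : R := (k.+2%:R^-1)%R.
have c21 : (0 < 2 * c + 1)%R by rewrite ltr_pwDr// mulr_ge0// ltW// (lt_trans _ c1).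
have eps0 : (0 < eps)%R by rewrite divr_gt0// subr_gt0.
have r0 : (0 < r)%R by rewrite invr_gt0.
have reps : (r <= eps)%R.
  rewrite -[leRHS]invrK lef_pV2 ?posrE ?invr_gt0//.
  apply: le_trans (ltW (archi_boundP _)) _; first by rewrite invr_ge0 ltW.
  by rewrite ler_nat (leq_trans Kk)// -addn2 leq_addr.
have gain : (1 + r <= c * (1 - 2 * r))%R.
  move: reps; rewrite /eps ler_pdivlMr// => H.
  by nra.
pose w := ((1 + r) * u k)%R.
have w0 : (0 <= w)%R by rewrite mulr_ge0// ltW// addr_gt0.
have phiw0 : 0 <= phi w by exact: (orlicz_ge0 hphi).
have mg : L0 (fun t => T y t / l)%R.
  by apply: measurable_funM => //; exact: block_operator_L0.
have xk0 := x_gt0 k.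
have sub : `[(x k / 2)%R, x k] `<=` I01.
  move=> s /=; rewrite in_itv/= => /andP[xs sx]; apply/I01P.
  by rewrite (le_trans _ xs) ?divr_ge0 ?(ltW xk0)//= (le_trans sx)// block_end_le1.
have low : phi w * (x k / 2)%:E <= ces_modular phi (fun t => T y t / l)%R.
  rewrite ces_modularE.
  apply: (@le_trans _ _ (\int[mu]_(s in `[(x k / 2)%R, x k])
      orlicz_ext phi (mean (fun t => T y t / l)%R s))); last first.
    apply: ge0_subset_integral => //; first exact: measurable_I01.
    - exact: measurable_ext_mean.
    - by move=> s; exact: ext_mean_ge0.
  apply: (@le_trans _ _ (\int[mu]_(s in `[(x k / 2)%R, x k]) cst (phi w) s)).
    rewrite integral_cst//= lebesgue_measure_itv/= lte_fin.
    rewrite ltr_pdivrMr// ltr_pMr// ltr1n -EFinB.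
    by rewrite [X in _ <= _ * X%:E](_ : _ = x k / 2)%R//; lra.
  apply: ge0_le_integral => //.
  - apply: (measurable_funS _ sub); first exact: measurable_I01.
    exact: measurable_ext_mean.
  - move=> s /=; rewrite in_itv/= => xsx.
    have -> : phi w = orlicz_ext phi w%:E by [].
    apply: (orlicz_ext_nd hphi); first by rewrite lee_fin.
    apply: le_trans (mean_block_ge y l0 xsx); rewrite lee_fin nk -/c /w.
    by rewrite mulrAC ler_pM2r.
apply: lt_le_trans low; rewrite EFinM muleC -muleA (muleC (2^-1)%:E) muleA.
apply: (@lt_le_trans _ _ (4%:E * (2^-1)%:E)).
  by rewrite -EFinM lte_fin; lra.
by apply: lee_wpmul2r; [rewrite lee_fin invr_ge0|exact: phi_large].
Qed.

(** The image of y is dominated by l times that of the constant sequence 1. *)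
Lemma ces_modular_block_le1 y (l : R) : linfty y -> (0 < l)%R ->
  (linfty_norm y <= l)%R -> ces_modular phi (fun t => T y t / l)%R <= 1.
Proof.
move=> ly l0 yl; apply: le_trans one_modular; apply: ces_modular_le => //.
- by apply: measurable_funM => //; exact: block_operator_L0.
- exact: block_operator_L0.
apply: aeW => t _; rewrite [leRHS]ger0_norm; last exact: (block_operator1_ge0 u_gt0).
rewrite normrM normfV (gtr0_norm l0) ler_pdivrMr//.
apply: le_trans (block_operator_le u_gt0 x_gt0 xS _ ly) _.
by rewrite mulrC ler_wpM2l// (block_operator1_ge0 u_gt0).
Qed.

(** By the two preceding estimates the scales l admissible for the image of y are
    exactly the l > 0 with l >= sup |y_n|. *)
Lemma ces_norm_block y : linfty y -> ces_norm phi (T y) = linfty_norm y.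
Proof.
move=> ly; have y0 : (0 <= linfty_norm y)%R.
  by apply: le_trans (linfty_norm_ub 0%N ly).
apply/eqP; rewrite eq_le; apply/andP; split.
  apply/ler_addgt0Pr => e e0; apply: ge_inf; first by exists 0%R => l [/ltW].
  have ye0 : (0 < linfty_norm y + e)%R by rewrite ltr_wpDl.
  by split=> //; apply: ces_modular_block_le1 => //; rewrite lerDl ltW.
apply: lb_le_inf.
  have y1 : (0 < linfty_norm y + 1)%R by rewrite ltr_wpDl.
  exists (linfty_norm y + 1)%R; split=> //.
  by apply: ces_modular_block_le1 => //; rewrite lerDl.
move=> l [l0 Tl]; apply: linfty_norm_le => n; rewrite leNgt; apply/negP.
by move=> /(ces_modular_block_gt1 l0); rewrite ltNge Tl.
Qed.

(** A negative coordinate would make the image negative on a whole block, which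
    has positive measure. *)
Lemma block_pos_of_ae y n :
  {ae mu, forall t, I01 t -> (0 <= T y t)%R} -> (0 <= y n)%R.
Proof.
move=> [A [mA A0 TA]]; rewrite leNgt; apply/negP => yn.
have [k _ nk] := block_coord_infinite n 0.
have bA : block x k `<=` A.
  move=> t bt; apply: TA => /= /(_ (block_I01 x_gt0 x0_le1 xS bt)); apply/negP.
  by rewrite -ltNge (block_operatorE u x_gt0 xS y bt) nk pmulr_llt0.
have : mu (block x k) <= mu A.
  by apply: le_measure; rewrite ?inE//; exact: measurable_itv.
rewrite A0 leNgt => /negP; apply; rewrite /block lebesgue_measure_itv/= lte_fin.
have xk : (x k.+1 < x k)%R.
  by apply: le_lt_trans (xS k) _; rewrite ltr_pdivrMr// ltr_pMr// ltr1n.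
by rewrite xk -EFinB lte_fin subr_gt0.
Qed.

Lemma block_isometric_copy :
  contains_order_isometric_copy_linfty (Ces phi) (ces_norm phi).
Proof.
exists T; last exact: ces_norm_block.
split.
- move=> y ly; split; first exact: block_operator_L0.
  have y0 : (0 <= linfty_norm y)%R by apply: le_trans (linfty_norm_ub 0%N ly).
  have y1 : (0 < linfty_norm y + 1)%R by rewrite ltr_wpDl.
  exists (linfty_norm y + 1)%R => //.
  apply: le_lt_trans (ces_modular_block_le1 ly y1 _) (ltry _).
  by rewrite lerDl.
- by move=> a y z ly lz; apply: aeW => t _; exact: block_operator_linear.
- by exists 1%R, 1%R; split=> // y ly; rewrite ces_norm_block// mul1r lexx.
- move=> y ly; split=> [y0|H n]; last exact: block_pos_of_ae.
  apply: aeW => t _.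
  have [[k bk]|nb] := blockP x t; last first.
    by rewrite (block_operator_out u x_gt0 xS y nb).
  by rewrite (block_operatorE u x_gt0 xS y bk) mulr_ge0// ltW.
Qed.

End block_copy.

(** * Bounds on the modulars of block functions *)

Section modular_bounds.
Context {R : realType} (phi : R -> \bar R) (hphi : orlicz_function phi).

Local Notation mu := (@lebesgue_measure R).
Local Notation mean f := (Defs.cesaro (fun t => `|f t|%R)).

(** The k-th block contributes at most x_k phi(u_k) to the integral. *)
Lemma orlicz_modular_block (u x : nat -> R) (delta : R) :
  (forall k, 0 < u k)%R -> (forall k, 0 < x k)%R -> (x 0%N <= 1)%R ->
  (forall k, x k.+1 <= x k / k.+2%:R)%R -> (0 <= delta)%R ->
  (forall k, (x k)%:E * phi (u k) <= (delta / (2 ^ k.+1)%:R)%:E) ->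
  orlicz_modular phi (EFin \o block_operator u x (cst 1%R)) <= delta%:E.
Proof.
move=> u0 x0 x01 xS delta0 xphi; pose f := block_operator u x (cst 1%R).
pose h t := orlicz_ext phi `|(f t)%:E|.
have h0 t : 0 <= h t by apply: (orlicz_ext_ge0 hphi).
have mh : measurable_fun I01 h.
  apply: (@measurable_fun_monotone_of _ _ _ _ (fun t => `|f t|%:E)).
    by apply: L0_normE; exact: block_operator_L0.
  by move=> s t _ _ st; exact: (orlicz_ext_nd hphi).
have sub : \bigcup_k block x k `<=` I01.
  by move=> t [k _]; exact: (block_I01 x0 x01 xS).
have mb k : measurable (block x k) by exact: measurable_itv.
have -> : orlicz_modular phi (EFin \o f) = \int[mu]_(t in \bigcup_k block x k) h t.
  rewrite /orlicz_modular integral_mkcond [RHS]integral_mkcond.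
  apply: eq_integral => t _; rewrite /patch.
  have [[k bk]|nb] := blockP x t.
    by rewrite !mem_set//; [exists k|exact: (block_I01 x0 x01 xS bk)].
  rewrite [in RHS]memNset; last by case=> k _ /nb.
  case: ifPn => // _; rewrite /= /f (block_operator_out u x0 xS _ nb) normr0.
  exact: (orlicz_0 hphi).
rewrite ge0_integral_bigcup//; last 2 first.
- by apply: (measurable_funS _ sub mh); exact: measurable_I01.
- apply/trivIsetP => i j _ _ /eqP ij; apply/eqP/negPn/negP => /set0P[t [bi bj]].
  by apply: ij; exact: (block_inj x0 xS bi bj).
apply: le_trans (epsilon_trick0 xpredT delta0).
apply: lee_nneseries => k _.
  by move=> _; apply: integral_ge0.
apply: le_trans (xphi k).
rewrite (eq_integral (cst (phi (u k)))); last first.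
  move=> t; rewrite inE => bt.
  by rewrite /h /f/= (block_operator1E u x0 xS bt) gtr0_norm.
rewrite integral_cst; last exact: mb.
rewrite muleC; apply: lee_wpmul2r.
  by apply: (orlicz_ge0 hphi); exact: ltW.
rewrite /block/= lebesgue_measure_itv/=; case: ifPn => _.
  by rewrite -EFinB lee_fin gerBl ltW.
by rewrite lee_fin ltW.
Qed.

(** The mean of f is at most b, and at most b * d to the right of d. *)
Lemma ces_modular_bounded (f : R -> R) (b d : R) : L0 f ->
  (0 < d <= 1)%R -> (0 <= b)%R -> (forall t, 0 <= f t <= b)%R ->
  (forall t, f t != 0%R -> (0 <= t <= d ^+ 2)%R) ->
  ces_modular phi f <= (2 * d)%:E * phi b.
Proof.
move=> mf /andP[d0 d1] b0 fb suppf; rewrite ces_modularE.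
have phib0 : 0 <= phi b by exact: (orlicz_ge0 hphi).
pose A : set R := `[0%R, (d ^+ 2)%R]%classic.
have mA : measurable A by exact: measurable_itv.
have int s : I01 s -> \int[mu]_(t in `[0%R, s]) `|f t|%:E <=
    b%:E * mu (A `&` `[0%R, s]).
  move=> Is; apply: (@le_trans _ _
    (\int[mu]_(t in `[0%R, s]) (b%:E * (\1_A t)%:E))).
    apply: ge0_le_integral => //.
    - exact: L0_norm_prefix.
    - by apply: measurable_funeM; apply/measurable_EFinP.
    - move=> t _; rewrite -EFinM lee_fin; have /andP[f0 fb1] := fb t.
      rewrite ger0_norm//; have [->|ft] := eqVneq (f t) 0%R.
        by rewrite mulr_ge0.
      rewrite indicE mem_set ?mulr1//= /A/= in_itv/=.
      exact: suppf.
  rewrite ge0_integralZl//; first by rewrite integral_indic.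
  by apply/measurable_EFinP.
have mu_prefix s : (0 <= s)%R -> mu `[0%R, s]%classic = s%:E.
  rewrite lebesgue_measure_itv/= lte_fin le_eqVlt => /predU1P[<-|s0].
    by rewrite ltxx.
  by rewrite s0 sube0.
have mean_le s (c : R) : I01 s -> (0 < s)%R ->
    mu (A `&` `[0%R, s]) <= c%:E -> mean f s <= (b * (c / s))%:E.
  move=> Is s0 Ac; rewrite /Defs.cesaro mulrA EFinM muleC.
  apply: lee_wpmul2r; first by rewrite lee_fin invr_ge0 ltW.
  by apply: le_trans (int s Is) _; rewrite EFinM lee_wpmul2l.
have mean_b s : I01 s -> mean f s <= b%:E.
  move=> Is; have /I01P/andP[s0 _] := Is.
  have [->|sn0] := eqVneq s 0%R.
    by rewrite /Defs.cesaro invr0 mul0e lee_fin.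
  have sp : (0 < s)%R by rewrite lt_def sn0.
  rewrite -[b]mulr1 -(divff sn0); apply: mean_le => //.
  by rewrite -mu_prefix//; apply: le_measure; rewrite ?inE//; exact: measurableI.
have mean_bd s : I01 s -> (d < s)%R -> mean f s <= (d * b)%:E.
  move=> Is ds; have s0 := lt_trans d0 ds.
  apply: (@le_trans _ _ (b * (d ^+ 2 / s))%:E).
    apply: mean_le => //; rewrite -mu_prefix ?exprn_ge0 ?(ltW d0)//.
    by apply: le_measure; rewrite ?inE//; exact: measurableI.
  rewrite lee_fin mulrC ler_wpM2r// ler_pdivrMr// expr2 ler_pM2l//.
  exact: ltW.
pose B : set R := `[0%R, d]%classic.
have mB : measurable B by exact: measurable_itv.
have dphi0 : 0 <= d%:E * phi b by rewrite mule_ge0// lee_fin ltW.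
have phiB0 s : 0 <= phi b * (\1_B s)%:E by rewrite mule_ge0.
have mphiB D : measurable_fun D (fun s => phi b * (\1_B s)%:E).
  by apply: measurable_funeM; apply/measurable_EFinP.
apply: (@le_trans _ _
    (\int[mu]_(s in I01) (d%:E * phi b + phi b * (\1_B s)%:E))).
  apply: ge0_le_integral => //; first exact: measurable_I01.
  - by move=> s; exact: ext_mean_ge0.
  - exact: measurable_ext_mean.
  - by apply: emeasurable_funD => //; exact: mphiB.
  - move=> s Is; have /I01P/andP[s0 _] := Is; have m0 := mean_ge0 f s0.
    rewrite indicE; have [ds|sd] := ltP d s.
      rewrite memNset ?mule0 ?adde0; last first.
        by rewrite /B/= in_itv/= s0/= leNgt ds.
      apply: le_trans (orlicz_ext_nd hphi m0 (mean_bd _ Is ds)) _.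
      by apply: (orlicz_star hphi) => //; rewrite (ltW d0).
    rewrite mem_set ?mule1; last by rewrite /B/= in_itv/= s0.
    apply: le_trans (orlicz_ext_nd hphi m0 (mean_b _ Is)) _.
    by rewrite leeDr.
have mI := @measurable_I01 R.
rewrite ge0_integralD//; last exact: mphiB.
rewrite [X in _ + X]ge0_integralZl//; last by apply/measurable_EFinP.
rewrite integral_indic//; have := integral_cst mu mI (d%:E * phi b).
rewrite /cst => ->.
rewrite /I01/= mu_prefix// mule1 mulr_natl mulr2n EFinD.
rewrite ge0_muleDl ?lee_fin ?(ltW d0)//; apply: leeD2l.
rewrite muleC; apply: lee_wpmul2r => //; rewrite -(mu_prefix d) ?(ltW d0)//.
by apply: le_measure; rewrite ?inE//; exact: measurableI.
Qed.

End modular_bounds.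

(** * The theorem *)

Theorem theorem3 (R : realType) (phi : R -> \bar R)
    (hphi : orlicz_function phi) :
  ((orlicz_ext phi (orlicz_b phi) = +oo ->
      forall e : R, (0 < e)%R -> exists2 D : R, (0 < D)%R &
        forall f : R -> R, orlicz_class phi f ->
          {ae @lebesgue_measure R, forall t, I01 t -> f t != 0%R ->
             (orlicz_inv phi e <= `|f t|)%R} ->
          ces_modular phi f
            <= D%:E * orlicz_modular phi (EFin \o f) + e%:E) ->
   ~ Delta2_infty phi ->
   contains_order_isometric_copy_linfty (Ces phi) (ces_norm phi))
  /\
  (Delta2_infty phi ->
   ~ contains_order_copy_linfty (Ces phi) (ces_norm phi)).
Proof.
split=> [modular_ineq nD2|]; last exact: Delta2_no_order_copy.
have [phib|phib] := pselect (orlicz_ext phi (orlicz_b phi) = +oo).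
  (* With e = 1/2, an Orlicz modular of at most 1 / (2 D) gives rho(f) <= 1. *)
  have [D D0 HD] := modular_ineq phib 2^-1%R ltac:(by rewrite invr_gt0).
  pose delta := Num.min 1%R (2 * D)^-1%R.
  have D20 : (0 < 2 * D)%R by rewrite mulr_gt0.
  have delta0 : (0 < delta)%R by rewrite lt_min ltr01 invr_gt0.
  have [u [x [x0d]]] :=
    geometric_blocks hphi (not_Delta2_fast_growth hphi phib nD2) delta0.
  move=> /all_and4[/all_and2[x0 xS] /all_and3[u0 phi1 _] xphi x4].
  have x01 : (x 0%N <= 1)%R by rewrite (le_trans x0d)// ge_min lexx.
  apply: (block_isometric_copy hphi u0 x0 x01 xS x4).
  have Ile := orlicz_modular_block hphi u0 x0 x01 xS (ltW delta0) xphi.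
  have mf := block_operator_L0 u x0 xS (cst 1%R).
  apply: le_trans (HD _ _ _) _.
  - by split=> //; exact: le_lt_trans Ile (ltry _).
  - apply: aeW => t _; have [[k bk]|nb] := blockP x t; last first.
      by rewrite (block_operator_out u x0 xS _ nb) eqxx.
    rewrite (block_operator1E u x0 xS bk) gtr0_norm// => _.
    apply: (orlicz_inv_le hphi (ltW (u0 k))); apply: lt_le_trans (phi1 k).
    by rewrite lte_fin invf_lt1// ltr1n.
  apply: (@le_trans _ _ (D%:E * delta%:E + (2^-1)%:E)).
    by apply: leeD2r; apply: lee_wpmul2l => //; rewrite lee_fin ltW.
  rewrite -EFinM -EFinD lee_fin.
  have : (D * delta <= D * (2 * D)^-1)%R.
    by rewrite ler_pM2l// ge_min lexx orbT.
  rewrite invfM mulrCA mulfV ?gt_eqF// mulr1; lra.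
(* Now phi(b) < oo: the blocks carry the value b and lie in [0, d ^ 2], where d is
   such that 2 d phi(b) <= 1. *)
case bE : (orlicz_b phi) (orlicz_b_gt0 hphi) phib => [b| |]//=.
rewrite lte_fin => b0 phib.
have phib0 : 0 <= phi b by apply: (orlicz_ge0 hphi); exact: ltW.
have phib_lty : phi b < +oo by rewrite ltey; exact/eqP.
have phib_fin : phi b \is a fin_num by rewrite ge0_fin_numE.
pose c := (1 + fine (phi b))%R.
have c1 : (1 <= c)%R by rewrite lerDl fine_ge0.
pose d := (2 * c)^-1%R.
have d0 : (0 < d)%R by rewrite invr_gt0 mulr_gt0// (lt_le_trans _ c1).
have d1 : (d <= 1)%R by rewrite invf_le1 ?mulr_gt0 ?(lt_le_trans _ c1)//; lra.
have [u [x [x0d]]] :=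
  geometric_blocks hphi (finite_b_fast_growth hphi bE phib_lty) (exprn_gt0 2 d0).
move=> /all_and4[/all_and2[x0 xS] /all_and3[u0 ub _] xphi x4].
have x01 : (x 0%N <= 1)%R by rewrite (le_trans x0d)// exprn_ile1// ltW.
apply: (block_isometric_copy hphi u0 x0 x01 xS x4).
have mf := block_operator_L0 u x0 xS (cst 1%R).
apply: le_trans (@ces_modular_bounded _ _ hphi _ b d mf _ _ _ _) _.
- by rewrite d0.
- exact: ltW.
- move=> t; have [[k bk]|nb] := blockP x t.
    by rewrite (block_operator1E u x0 xS bk) -ub (ltW b0) lexx.
  by rewrite (block_operator_out u x0 xS _ nb) lexx ltW.
- move=> t; have [[k]|nb] := blockP x t; last first.
    by rewrite (block_operator_out u x0 xS _ nb) eqxx.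
  rewrite /block/= in_itv/= => /andP[xt tx] _.
  rewrite (ltW (lt_trans (x0 k.+1) xt))/= (le_trans tx)//.
  by rewrite (le_trans _ x0d)// (block_end_nincr x0 xS).
rewrite -(fineK phib_fin) -EFinM lee_fin /d invfM mulrA divff// mul1r.
by rewrite mulrC ler_pdivrMr ?(lt_le_trans _ c1)// mul1r lerDr.
Qed.
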